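(* Let $\mathcal{G}=(V,E)$ be a graph with an adapted complex structure $J$. If $(\mathfrak{n}_{\mathcal{G}},J)$ admits an SKT metric $\langle\cdot,\cdot\rangle$ such that $E$ is an orthogonal set and such that the orthogonal complement of the center $\mathfrak{z}$ of $\mathfrak{n}_{\mathcal{G}}$ is $\mathfrak{z}^{\perp}=\mathrm{span}\{v\in V\mid \deg(v)>0\}$, then $\mathcal{G}$ is basic.
   Context: Graphs are finite and simple. For a graph $\mathcal{G}=(V,E)$ label $V=\{v_1,\dots,v_n\}$ and write $e_{i,j}$ ($i<j$) for the edge joining $v_i$ and $v_j$, if it exists. The Lie algebra $\mathfrak{n}_{\mathcal{G}}$ is the real vector space with basis $V\cup E$ and Lie bracket $[v_i,v_j]=e_{i,j}$ for $i<j$ if $v_i,v_j$ are adjacent, $[v_i,v_j]=0$ if they are not adjacent, and all elements of $E$ central. A complex structure on a real Lie algebra $\mathfrak{g}$ is a linear map $J:\mathfrak{g}\to\mathfrak{g}$ with $J^2=-\mathrm{Id}$ and $[x,y]+J([Jx,y]+[x,Jy])-[Jx,Jy]=0$ for all $x,y\in\mathfrak{g}$. An adapted complex structure on the graph $\mathcal{G}$ is a complex structure $J$ on $\mathfrak{n}_{\mathcal{G}}$ such that for every $x\in V\cup E$ either $Jx\in V\cup E$ or $-Jx\in V\cup E$. A Hermitian structure on a Lie algebra $\mathfrak{g}$ is a pair $(J,\langle\cdot,\cdot\rangle)$ with $J$ a complex structure and $\langle\cdot,\cdot\rangle$ an inner product with $\langle Jx,Jy\rangle=\langle x,y\rangle$.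 Its Bismut torsion $3$-form is $$c(x,y,z)=-\langle[Jx,Jy],z\rangle-\langle[Jy,Jz],x\rangle-\langle[Jz,Jx],y\rangle,$$ and the metric is SKT (strong Kähler with torsion) if $dc=0$, where $d$ is the Chevalley–Eilenberg differential of $\mathfrak{g}$. A graph is basic if it is a disjoint union of copies of: $\mathbb{A}_1$ (two vertices, no edges), $\mathbb{A}_2$ (three vertices and exactly one edge), $\mathbb{A}_3$ (four vertices and exactly two edges, which share no vertex). *)

(* Defs.v *)
From HB Require Import structures.
From mathcomp Require Import all_boot all_order all_algebra.
From mathcomp Require Import ring.
From mathcomp Require Import reals.

Set Implicit Arguments.
Unset Strict Implicit.
Unset Printing Implicit Defensive.

Import Order.TTheory GRing.Theory Num.Theory.
Local Open Scope ring_scope.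

Record sgraph := SGraph {
  vertex :> finType;
  adj : rel vertex;
  adj_sym : symmetric adj;
  adj_irr : irreflexive adj }.

Definition deg (G : sgraph) (v : G) : nat := #|[set w | adj v w]|.

Definition graph_iso (G H : sgraph) : Prop :=
  exists2 f : G -> H, bijective f & forall x y, adj (f x) (f y) = adj x y.

Section DisjointUnion.
Variables (k : nat) (F : 'I_k -> sgraph).

Definition dunion_adj : rel {i : 'I_k & F i} :=
  fun u v => (tag u == tag v) && adj (tagged u) (tagged_as u v).

Lemma dunion_adj_sym : symmetric dunion_adj.
Proof.
move=> [i x] [j y]; rewrite /dunion_adj /= eq_sym.
have [eq_ij|//] := eqVneq i j; subst j => /=.
rewrite (tagged_asE (u := Tagged F x) y) (tagged_asE (u := Tagged F y) x).
exact: adj_sym.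
Qed.

Lemma dunion_adj_irr : irreflexive dunion_adj.
Proof.
move=> [i x]; rewrite /dunion_adj (tagged_asE (u := Tagged F x) x).
by rewrite adj_irr andbF.
Qed.

Definition dunion : sgraph := SGraph dunion_adj_sym dunion_adj_irr.
End DisjointUnion.

Section ListGraph.
Variables (n : nat) (s : seq (nat * nat)).

Definition list_adj : rel 'I_n :=
  fun i j => (i != j) && (((val i, val j) \in s) || ((val j, val i) \in s)).

Lemma list_adj_sym : symmetric list_adj.
Proof. by move=> i j; rewrite /list_adj eq_sym orbC. Qed.

Lemma list_adj_irr : irreflexive list_adj.
Proof. by move=> i; rewrite /list_adj eqxx. Qed.

Definition list_graph : sgraph := SGraph list_adj_sym list_adj_irr.
End ListGraph.

Definition graphA1 : sgraph := list_graph 2 [::].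
Definition graphA2 : sgraph := list_graph 3 [:: (0, 1)]%N.
Definition graphA3 : sgraph := list_graph 4 [:: (0, 1); (2, 3)]%N.

Definition basic (G : sgraph) : Prop :=
  exists (k : nat) (F : 'I_k -> sgraph),
    (forall i, F i = graphA1 \/ F i = graphA2 \/ F i = graphA3)
    /\ graph_iso G (dunion F).

Section LieAlgebra.
Variables (R : realFieldType) (L : lmodType R) (br : L -> L -> L).

Definition lie_bracket : Prop :=
  [/\ forall y, linear (br^~ y), forall x, linear (br x), forall x, br x x = 0
    & forall x y z, br x (br y z) + br y (br z x) + br z (br x y) = 0].

Definition central (x : L) : Prop := forall y, br x y = 0.

Definition complex_structure (J : {linear L -> L}) : Prop :=
  (forall x, J (J x) = - x) /\
  forall x y, br x y + J (br (J x) y + br x (J y)) - br (J x) (J y) = 0.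

Definition hermitian_structure (J : {linear L -> L}) (g : {dot L for idfun}) : Prop :=
  complex_structure J /\ forall x y, g (J x) (J y) = g x y.

Definition bismut_torsion (J : {linear L -> L}) (g : {dot L for idfun}) (x y z : L) : R :=
  - g (br (J x) (J y)) z - g (br (J y) (J z)) x - g (br (J z) (J x)) y.

(** Chevalley-Eilenberg differential on 3-forms with trivial coefficients:
    [\sum_(i < j) (-1) ^+ (i + j) * c ([x_i, x_j], .., ^x_i, .., ^x_j, ..)]. *)
Definition ce_diff3 (c : L -> L -> L -> R) (x0 x1 x2 x3 : L) : R :=
  - c (br x0 x1) x2 x3 + c (br x0 x2) x1 x3 - c (br x0 x3) x1 x2
  - c (br x1 x2) x0 x3 + c (br x1 x3) x0 x2 - c (br x2 x3) x0 x1.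

Definition skt_metric (J : {linear L -> L}) (g : {dot L for idfun}) : Prop :=
  hermitian_structure J g /\
  forall x0 x1 x2 x3, ce_diff3 (bismut_torsion J g) x0 x1 x2 x3 = 0.
End LieAlgebra.

(** The vertices are labelled by [enum_rank]; on the vertex type ['I_n] this is
    the usual labelling [0, .., n-1].  The edge [e_{i,j}], [i < j], is the pair
    [(v_i, v_j)]. *)
Definition edge (G : sgraph) : finType :=
  {p : G * G | (enum_rank p.1 < enum_rank p.2)%N && adj p.1 p.2}.

Definition nlie (R : realFieldType) (G : sgraph) := {ffun G + edge G -> R^o}.
HB.instance Definition _ R G :=
  Vector.copy (@nlie R G) {ffun G + edge G -> R^o}.

Section GraphLie.
Variables (R : realFieldType) (G : sgraph).
Local Notation nG := (nlie R G).

Definition nbasis (b : G + edge G) : nG := [ffun b' => (b' == b)%:R].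

(** The bilinear extension of the bracket on [V], in coordinates; see
    [nbracket_adj], [nbracket_nadj], [nbracket_edge], [nbracket_lie]. *)
Definition nbracket (x y : nG) : nG :=
  [ffun b => match b with
             | inl _ => 0
             | inr e => x (inl (val e).1) * y (inl (val e).2)
                        - x (inl (val e).2) * y (inl (val e).1)
             end].

Lemma nbracket_adj (e : edge G) :
  nbracket (nbasis (inl (val e).1)) (nbasis (inl (val e).2)) = nbasis (inr e).
Proof.
apply/ffunP => -[v|f]; rewrite !ffunE //.
have E (u v : G) : (inl u == inl v :> G + edge G) = (u == v) by [].
rewrite !E.
have -> : (inr f == inr e :> G + edge G) = (f == e) by [].
case: e f => [[a b] ab] [[c d] cd]; rewrite -!val_eqE /= xpair_eqE.
move: ab cd => /= /andP[lt_ab _] /andP[lt_cd _].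
have -> : (d == a)%:R * (c == b)%:R = 0 :> R.
  case: eqP => [da|_]; last by rewrite mul0r.
  case: eqP => [cb|_]; last by rewrite mulr0.
  by subst; move: (ltn_trans lt_ab lt_cd); rewrite ltnn.
by rewrite subr0 -natrM mulnb.
Qed.

Lemma nbracket_nadj (u v : G) :
  ~~ adj u v -> nbracket (nbasis (inl u)) (nbasis (inl v)) = 0.
Proof.
move=> nuv; apply/ffunP => -[w|[[c d] cd]]; rewrite !ffunE //=.
have E (a b : G) : (inl a == inl b :> G + edge G) = (a == b) by [].
rewrite !E; move: (cd) => /= /andP[_ adj_cd].
have -> : (c == u)%:R * (d == v)%:R = 0 :> R.
  case: eqP => [cu|_]; last by rewrite mul0r.
  case: eqP => [dv|_]; last by rewrite mulr0.
  by subst; rewrite adj_cd in nuv.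
have -> : (d == u)%:R * (c == v)%:R = 0 :> R.
  case: eqP => [du|_]; last by rewrite mul0r.
  case: eqP => [cv|_]; last by rewrite mulr0.
  by subst; rewrite adj_sym adj_cd in nuv.
by rewrite subr0.
Qed.

Lemma nbracket_edge (e : edge G) : central nbracket (nbasis (inr e)).
Proof.
by move=> y; apply/ffunP => -[w|f]; rewrite !ffunE //= !mul0r subr0.
Qed.

Lemma nbracket_lie : lie_bracket nbracket.
Proof.
split.
- move=> y a x x'; apply/ffunP => -[w|e]; rewrite !ffunE /= ?scaler0 ?addr0 //.
  by rewrite /GRing.scale /=; ring.
- move=> x a y y'; apply/ffunP => -[w|e]; rewrite !ffunE /= ?scaler0 ?addr0 //.
  by rewrite /GRing.scale /=; ring.
- by move=> x; apply/ffunP => -[w|e]; rewrite !ffunE //= mulrC subrr.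
- move=> x y z; apply/ffunP => -[w|e]; rewrite !ffunE /= ?addr0 //.
  by rewrite !(mulr0, mul0r, subr0, addr0).
Qed.

Definition adapted_complex_structure (J : {linear nG -> nG}) : Prop :=
  complex_structure nbracket J /\
  forall b, exists b', J (nbasis b) = nbasis b' \/ - J (nbasis b) = nbasis b'.
End GraphLie.

(* Main.v *)
Require Import Defs.
From mathcomp Require Import all_boot all_order all_algebra.
From mathcomp Require Import reals.
From mathcomp Require Import lra zify.

(** J permutes V and E up to sign, without fixed points, so |V| + |E| is even.
    Evaluating dc = 0 at (z, Jz, x, Jx) with z central shows that J preserves
    the set of non-isolated vertices.  For two such vertices v and w, evaluating
    dc = 0 at (v, Jv, w, Jw) gives
      2 <[v, Jv], [w, Jw]> = |[v, w]|^2 + |[v, Jw]|^2 + |[Jv, w]|^2 + |[Jv, Jw]|^2;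
    if w differs from v and from Jv up to sign, then [v, Jv] and [w, Jw] are zero
    or distinct edges up to sign, so the left-hand side vanishes and v, w are not
    adjacent.  Hence every degree is at most 1; with m edges and i isolated
    vertices, m + i is even, so the edges and isolated vertices can be paired
    off into copies of A_1, A_2, A_3. *)

Set Implicit Arguments.
Unset Strict Implicit.
Unset Printing Implicit Defensive.

(** * Splitting the vertex set into copies of the basic graphs *)

Definition piece_edges (n : nat) : seq (nat * nat) :=
  match n with 3 => [:: (0, 1)] | 4 => [:: (0, 1); (2, 3)] | _ => [::] end.

Lemma perm_flattenP (G : finType) (s : seq (seq G)) :
    perm_eq (flatten s) (enum G) ->
  sumn (map size s) = #|G| /\ forall x, exists2 p, p \in s & x \in p.
Proof.
move=> sG; split; first by rewrite -[LHS]size_flatten (perm_size sG) cardT.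
by move=> x; apply/flattenP; rewrite (perm_mem sG) mem_enum.
Qed.

Section Pieces.
Variable G : sgraph.
Implicit Types (x y : G) (p : seq G) (s : seq (seq G)).

(** The graphs A_1, A_2, A_3 have 2, 3 and 4 vertices, so the length of [p] alone selects the one it
    must be a copy of. Closure under adjacency makes [p] a union of connected components. *)
Definition piece p : Prop :=
  [/\ (1 < size p < 5),
      forall x y, x \in p -> adj x y -> y \in p &
      forall a b, adj (tnth (in_tuple p) a) (tnth (in_tuple p) b) =
                  list_adj (piece_edges (size p)) a b].

(** The map [h] from the disjoint union of the pieces to [G] is onto, and both sides have the same
    number of vertices, so a section [k] of [h] is a bijection; it is the required isomorphism. *)
Lemma pieces_basic s :
  perm_eq (flatten s) (enum G) -> (forall p, p \in s -> piece p) -> basic G.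
Proof.
move=> /perm_flattenP[size_s mem_s] s_piece.
pose pc (i : 'I_(size s)) := tnth (in_tuple s) i.
have pcP i : piece (pc i) by apply/s_piece/mem_tnth.
pose F i := list_graph (size (pc i)) (piece_edges (size (pc i))).
pose h (u : dunion F) : G := tnth (in_tuple (pc (tag u))) (tagged u).
have h_surj i x : x \in pc i -> exists a, x = h (Tagged F (a : F i)).
  by move=> /(tnthP (in_tuple (pc i)))[a ->]; exists a.
have [k hk] : exists k : G -> dunion F, forall x, h (k x) = x.
  apply: (@fin_all_exists G (fun=> dunion F) (fun x u => h u = x)) => x.
  have [p /(tnthP (in_tuple s))[i ->] /h_surj[a ->]] := mem_s x.
  by exists (Tagged F a).
have card_F : #|dunion F| = #|G|.
  rewrite card_tagged -size_s; congr sumn.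
  under eq_map => i do rewrite card_ord /pc (tnth_nth [::]) /=.
  by rewrite (map_comp (fun i => size (nth [::] s i)) val) val_enum_ord
             (map_comp size (nth [::] s)) -/(mkseq _ _) mkseq_nth.
have k_bij : bijective k.
  by apply: inj_card_bij; [apply: can_inj hk|rewrite card_F].
have kh : cancel h k by apply/(bij_can_sym k_bij).
exists (size s), F; split.
  move=> i; have [size_i _ _] := pcP i; rewrite /F.
  by move: (size _) size_i => [|[|[|[|[|]]]]] //; auto.
exists k => // x y; rewrite -[in RHS](hk x) -[in RHS](hk y).
move: (k x) (k y) => u v.
have [_ closed_u adj_u] := pcP (tag u).
apply/idP/idP.
  case: u v closed_u adj_u => i a [j b] /= closed_u adj_u /andP[/=/eqP ij].
  subst j; rewrite /h adj_u.
  by rewrite (tagged_asE (u := Tagged F a) b).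
(* The piece of [u] is closed under adjacency, so it contains [h v]; injectivity of [h] then puts
   [v] in the same summand as [u]. *)
move=> uv; have /h_surj[b hv] := closed_u _ _ (mem_tnth _ (in_tuple _)) uv.
have v_b := can_inj kh hv; move: uv; rewrite v_b /h /= adj_u.
by rewrite /dunion_adj /= eqxx tagged_asE.
Qed.

(** * Graphs in which every vertex has at most one neighbour *)

Hypothesis matching : forall x y z, adj x y -> adj x z -> y = z.

(** When degrees are at most one, naming the edges and the isolated vertices of [p] determines all
    adjacencies that involve its members. *)
Definition piece_shape p : Prop :=
  [\/ exists x y, [/\ p = [:: x; y], deg x = 0 & deg y = 0],
      exists x y z, [/\ p = [:: x; y; z], adj x y & deg z = 0] |
      exists x y z t, [/\ p = [:: x; y; z; t], adj x y & adj z t]].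

Lemma deg0_nadj x : deg x = 0 -> forall y, adj x y = false.
Proof.
move=> x0 y; apply/negbTE/negP => xy.
by have := card0_eq x0 y; rewrite inE xy.
Qed.

Lemma matching_adj x y z : adj x y -> adj x z = (z == y).
Proof.
move=> xy; apply/idP/eqP => [xz|->//].
exact: matching xz xy.
Qed.

Lemma piece_shapeP p : uniq p -> piece_shape p -> piece p.
Proof.
(* The only neighbour of an endpoint of an edge is the other endpoint. Every adjacency thus becomes
   an equality test, which [uniq p] decides. *)
have E x y : adj x y ->
    (forall z, adj x z = (z == y)) * (forall z, adj y z = (z == x)).
  by move=> xy; split=> z; apply: matching_adj; rewrite // adj_sym.
move=> uniq_p [[x [y [pE x0 y0]]]|[x [y [z [pE xy z0]]]]
              |[x [y [z [t [pE xy zt]]]]]]; subst p; move: uniq_p;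
  rewrite /= ?inE ?negb_or ?andbT.
- have [Dx Dy] := (deg0_nadj x0, deg0_nadj y0).
  move=> _; split=> // [u v|a b].
    by rewrite !inE => /orP[] /eqP->; rewrite ?Dx ?Dy.
  rewrite !(tnth_nth x) /list_adj.
  by case: a b => [[|[|[]]] // ?] [[|[|[]]] // ?] /=; rewrite ?Dx ?Dy andbF.
- have [Ex Ey] := E _ _ xy; have Dz := deg0_nadj z0.
  move=> /andP[/andP[x_y x_z] y_z].
  have nE := (negbTE x_y, negbTE x_z, negbTE y_z).
  split=> // [u v|a b].
    by rewrite !inE => /or3P[] /eqP->; rewrite ?Ex ?Ey ?Dz // => ->; rewrite ?orbT.
  rewrite !(tnth_nth x) /list_adj -val_eqE.
  by case: a b => [[|[|[|[]]]] // ?] [[|[|[|[]]]] // ?] /=;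
     rewrite ?Ex ?Ey ?Dz ?(eq_sym z) ?(eq_sym y x) ?eqxx ?nE.
- have [Ex Ey] := E _ _ xy; have [Ez Et] := E _ _ zt.
  move=> /andP[/and3P[x_y x_z x_t] /andP[/andP[y_z y_t] z_t]].
  have nE := (negbTE x_y, negbTE x_z, negbTE x_t,
              negbTE y_z, negbTE y_t, negbTE z_t).
  split=> // [u v|a b].
    by rewrite !inE => /or4P[] /eqP->; rewrite ?Ex ?Ey ?Ez ?Et => ->; rewrite ?orbT.
  rewrite !(tnth_nth x) /list_adj -val_eqE.
  by case: a b => [[|[|[|[|[]]]]] // ?] [[|[|[|[|[]]]]] // ?] /=;
     rewrite ?Ex ?Ey ?Ez ?Et ?(eq_sym t) ?(eq_sym z x) ?(eq_sym z y) ?(eq_sym y x)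
             ?eqxx ?nE.
Qed.

Lemma even_isolated_pieces (vs : seq G) :
    ~~ odd (size vs) -> {in vs, forall x, deg x = 0} ->
  exists2 s, perm_eq (flatten s) vs & forall p, p \in s -> piece_shape p.
Proof.
have [n] := ubnP (size vs); elim: n vs => // n IHn [|x [|y vs]] //=.
  by exists [::].
rewrite negbK => size_vs ev vs0.
have [||z z_vs|s s_vs sP] := IHn vs; rewrite ?(ltnW size_vs) //; first lia.
  by apply: vs0; rewrite !inE z_vs !orbT.
exists ([:: x; y] :: s); first by rewrite /= !perm_cons.
move=> p; rewrite inE => /predU1P[->|/sP//]; apply: Or31; exists x, y.
by rewrite !vs0 ?inE ?eqxx ?orbT.
Qed.

(** Edges are removed two at a time, each pair giving an A_3, hence the induction on a bound for
    [size es]. If one edge is left over, parity provides an isolated vertex that completes it to an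
    A_2. The remaining isolated vertices are even in number and pair off into copies of A_1. *)
Lemma matching_pieces (es : seq (G * G)) (vs : seq G) :
    ~~ odd (size es + size vs) ->
    {in es, forall e, adj e.1 e.2} -> {in vs, forall x, deg x = 0} ->
  exists2 s, perm_eq (flatten s) (flatten [seq [:: e.1; e.2] | e <- es] ++ vs)
           & forall p, p \in s -> piece_shape p.
Proof.
have [n] := ubnP (size es).
elim: n es vs => // n IHn [|[x y] [|[z t] es]] vs /=.
- by move=> _ ev _; apply: even_isolated_pieces.
- case: vs => // z vs _ /= ev es1 vs0.
  have [||s s_vs sP] := @even_isolated_pieces vs; first by lia.
    by move=> t t_vs; apply: vs0; rewrite inE t_vs orbT.
  exists ([:: x; y; z] :: s); first by rewrite /= !perm_cons.
  move=> p; rewrite inE => /predU1P[->|/sP//]; apply: Or32; exists x, y, z.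
  by split; rewrite ?vs0 ?inE ?eqxx ?(es1 (x, y)) ?inE.
- move=> size_es ev es1 vs0.
  have [||e e_es||s s_vs sP] := IHn es vs => //; try lia.
    by apply: es1; rewrite !inE e_es !orbT.
  exists ([:: x; y; z; t] :: s); first by rewrite /= !perm_cons.
  move=> p; rewrite inE => /predU1P[->|/sP//]; apply: Or33; exists x, y, z, t.
  by rewrite (es1 (x, y)) ?(es1 (z, t)) ?inE ?eqxx ?orbT.
Qed.

(** Two edges that share a vertex have the same endpoints by [matching], and the order on
    [enum_rank] excludes the reversed pair, so they are equal. *)
Lemma matching_uniq (es : seq (G * G)) :
    uniq es ->
    {in es, forall e, (enum_rank e.1 < enum_rank e.2) && adj e.1 e.2} ->
  uniq (flatten [seq [:: e.1; e.2] | e <- es]).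
Proof.
elim: es => //= -[x y] es IHes /andP[xy_es uniq_es] esP.
have /= /andP[lt_xy xy] := esP (x, y) (mem_head _ _).
have {}esP : {in es, forall e, (enum_rank e.1 < enum_rank e.2) && adj e.1 e.2}.
  by move=> e e_es; apply: esP; rewrite inE e_es orbT.
have yx : adj y x by rewrite adj_sym.
rewrite IHes // andbT inE negb_or -andbA; apply/and3P; split.
- by apply: contraTneq lt_xy => ->; rewrite ltnn.
- apply: contra xy_es => /flatten_mapP[[a b] ab_es].
  have /andP[/= lt_ab ab] := esP _ ab_es; have ba : adj b a by rewrite adj_sym.
  rewrite !inE => /orP[]/eqP E; move: lt_ab ab ba ab_es; rewrite -E.
    by move=> _ /(matching xy)->.
  by move=> lt _ /(matching xy) E'; move: lt; rewrite -E' ltnNge ltnW.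
- apply: contra xy_es => /flatten_mapP[[a b] ab_es].
  have /andP[/= lt_ab ab] := esP _ ab_es; have ba : adj b a by rewrite adj_sym.
  rewrite !inE => /orP[]/eqP E; move: lt_ab ab ba ab_es; rewrite -E.
    by move=> lt /(matching yx) E'; move: lt; rewrite -E' ltnNge ltnW.
  by move=> _ _ /(matching yx)->.
Qed.

Lemma matching_basic : ~~ odd (#|G| + #|edge G|) -> basic G.
Proof.
pose es := [seq val e | e <- enum (edge G)].
pose vs := [seq x <- enum G | deg x == 0].
have esP : {in es, forall e, (enum_rank e.1 < enum_rank e.2) && adj e.1 e.2}.
  by move=> _ /mapP[e _ ->]; case: e.
have mem_es x y : adj x y -> ((x, y) \in es) || ((y, x) \in es).
  move=> xy.
  have mem e : (enum_rank e.1 < enum_rank e.2) && adj e.1 e.2 -> e \in es.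
    by move=> eP; apply/mapP; exists (Sub e eP); rewrite ?mem_enum.
  have [lt_xy|lt_yx|/ord_inj/enum_rank_inj eq_xy] :=
      ltngtP (enum_rank x) (enum_rank y).
  - by rewrite mem //= lt_xy.
  - by rewrite [X in _ || X]mem ?orbT //= lt_yx adj_sym.
  - by rewrite eq_xy adj_irr in xy.
have vs0 : {in vs, forall x, deg x = 0}
  by move=> x; rewrite mem_filter => /andP[/eqP].
have perm_es_vs : perm_eq (flatten [seq [:: e.1; e.2] | e <- es] ++ vs) (enum G).
  apply: uniq_perm; rewrite ?enum_uniq //.
    rewrite cat_uniq filter_uniq ?enum_uniq // matching_uniq //; last first.
      by rewrite map_inj_uniq ?enum_uniq //; apply: val_inj.
    rewrite andbT /=; apply/hasPn => x /vs0/deg0_nadj x0.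
    apply/negP => /flatten_mapP[[a b] /esP /= /andP[_ ab]].
    have ba : adj b a by rewrite adj_sym.
    by rewrite !inE => /orP[]/eqP E; move: ab ba; rewrite -E x0.
  move=> x; rewrite mem_enum mem_cat mem_filter mem_enum andbT.
  have [//|/=] := eqVneq (deg x) 0; rewrite ?orbT // orbF -lt0n.
  case/card_gt0P => y; rewrite inE => /mem_es/orP[] xy;
    by apply/flatten_mapP; eexists; [apply: xy|rewrite !inE eqxx ?orbT].
have es_adj : {in es, forall e, adj e.1 e.2} by move=> e /esP/andP[].
(* With m edges and i isolated vertices, [#|G|] is 2m + i, so the parity of [#|G| + #|edge G|] is
   that of m + i. *)
move=> ev; have [|s s_es sP] := matching_pieces _ es_adj vs0.
  have /perm_size := perm_es_vs.
  rewrite size_cat size_flatten /shape -map_comp /= -cardT.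
  have -> : sumn (map (size \o (fun e : G * G => [:: e.1; e.2])) es) = (size es).*2.
    by elim: es {esP mem_es perm_es_vs es_adj} => //= e es ->; rewrite doubleS.
  rewrite size_map -cardE => /(congr1 odd); rewrite oddD odd_double /= => E.
  by move: ev; rewrite !oddD -E addbC.
have s_G := perm_trans s_es perm_es_vs.
apply: (pieces_basic s_G) => p p_s; apply: piece_shapeP (sP _ p_s).
move: p_s; have : uniq (flatten s) by rewrite (perm_uniq s_G) enum_uniq.
elim: s {s_es sP s_G} => //= q s IHs; rewrite cat_uniq inE => /and3P[uq _ us].
by case/predU1P => [->|/IHs->].
Qed.
End Pieces.

Import Order.TTheory GRing.Theory Num.Theory.
Local Open Scope ring_scope.

(** * SKT metrics on two-step nilpotent Lie algebras *)

Section TwoStepNilpotentSKT.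
Variables (R : realFieldType) (L : lmodType R) (br : L -> L -> L).
Hypothesis br_lie : lie_bracket br.
Hypothesis br_central : forall x y, central br (br x y).
Variables (J : {linear L -> L}) (g : {dot L for idfun}).
Hypothesis gJ_skt : skt_metric br J g.

Lemma br0l y : br 0 y = 0.
Proof.
have [lin _ _ _] := br_lie; have := lin y (-1) 0 0.
by rewrite scaler0 addr0 scaleN1r addNr.
Qed.

Lemma brNl x y : br (- x) y = - br x y.
Proof.
have [lin _ _ _] := br_lie; have := lin y (-1) x 0.
by rewrite br0l !addr0 !scaleN1r.
Qed.

Lemma br0r x : br x 0 = 0.
Proof.
have [_ lin _ _] := br_lie; have := lin x (-1) 0 0.
by rewrite scaler0 addr0 scaleN1r addNr.
Qed.

Lemma brC x y : br y x = - br x y.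
Proof.
have [linl linr alt _] := br_lie.
have := alt (x + y); have := linl (x + y) 1 x y; rewrite !scale1r => ->.
have := linr x 1 x y; have := linr y 1 x y; rewrite !scale1r => -> ->.
by rewrite !alt add0r addr0 => /eqP; rewrite addr_eq0 -eqr_oppLR => /eqP.
Qed.

Lemma brNr x y : br x (- y) = - br x y.
Proof. by rewrite brC brNl brC opprK. Qed.

Lemma central_brr x y : central br x -> br y x = 0.
Proof. by move=> cx; rewrite brC cx oppr0. Qed.

Lemma dotC x y : g x y = g y x.
Proof. by rewrite hermC /= expr0 mul1r. Qed.

Lemma skt_JJ x : J (J x) = - x.
Proof. by case: gJ_skt => -[[H _] _] _. Qed.

(** This is what integrability at [(z, x)] leaves once the brackets of [z] with [x] and [J x]
    vanish. *)
Lemma J_central_brl z x : central br z -> br (J z) (J x) = J (br (J z) x).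
Proof.
move=> cz; case: gJ_skt => -[[_ int] _] _; have := int z x.
by rewrite !cz !(add0r, addr0) => /eqP; rewrite subr_eq0 => /eqP.
Qed.

Lemma skt_dotJJ x y : g (J x) (J y) = g x y.
Proof. by case: gJ_skt => -[_ H] _. Qed.

Lemma dot_sq_eq0 x : g x x <= 0 -> x = 0.
Proof.
have [//|/(@neq0_dnorm_gt0 _ _ _ g)] := eqVneq x 0.
by move=> gt0 le0; move: (lt_le_trans gt0 le0); rewrite ltxx.
Qed.

Lemma dot_sq_ge0 x : 0 <= g x x.
Proof.
by have [->|/(@neq0_dnorm_gt0 _ _ _ g)/ltW//] := eqVneq x 0; rewrite linear0r.
Qed.

(* Evaluates [dc = 0] at [(z, Jz, x, Jx)], where it reads [-2 |[Jz, x]|^2 = 0]. *)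
Lemma skt_J_central z :
    central br z -> (forall x y, g (br x y) (J z) = 0) ->
  central br (J z).
Proof.
move=> cz orth x; pose a := br (J z) x.
have Ja : br (J z) (J x) = J a by rewrite J_central_brl.
have c_a : central br a by apply: br_central.
have c_Ja : central br (J a) by rewrite -Ja; apply: br_central.
apply: dot_sq_eq0.
case: gJ_skt => _ /(_ z (J z) x (J x)); rewrite /ce_diff3 /bismut_torsion.
set b := br x (J x); have c_b : central br b by apply: br_central.
rewrite -/a Ja !skt_JJ !(brNl, brNr, cz, c_a, c_Ja, central_brr _ cz).
rewrite !(central_brr _ c_a, central_brr _ c_Ja) !raddf0 !(br0l, br0r) -/a.
rewrite !(oppr0, linear0l, linear0r, linearNl, linearNr, orth, skt_dotJJ) /=.
lra.
Qed.

(* Evaluates [dc = 0] at [(x, Jx, y, Jy)]: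
   [2 <[x, Jx], [y, Jy]> = |[x, y]|^2 + |[x, Jy]|^2 + |[Jx, y]|^2 + |[Jx, Jy]|^2]. *)
Lemma skt_bracket_eq0 x y :
    (forall a b, g (br a b) x = 0) -> (forall a b, g (br a b) (J x) = 0) ->
    (forall a b, g (br a b) y = 0) -> (forall a b, g (br a b) (J y) = 0) ->
  g (br x (J x)) (br y (J y)) = 0 -> br x y = 0.
Proof.
move=> ox oJx oy oJy o_xy; apply: dot_sq_eq0.
case: gJ_skt => _ /(_ x (J x) y (J y)); rewrite /ce_diff3 /bismut_torsion.
rewrite !skt_JJ !(ox, oJx, oy, oJy) !(brNl, brNr) (brC y (J y)) (brC x (J x)).
rewrite !(opprK, linearNl, linearNr) /= (dotC (br y _)) o_xy.
have := dot_sq_ge0 (br x (J y)); have := dot_sq_ge0 (br (J x) y).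
have := dot_sq_ge0 (br (J x) (J y)).
lra.
Qed.
End TwoStepNilpotentSKT.

(** * Graph Lie algebras and the basis permutation induced by an adapted J *)

Lemma involution_card_even (T : finType) (s : T -> T) :
  involutive s -> (forall x, s x != x) -> ~~ odd #|T|.
Proof.
(* [A] takes the element of smaller rank from each orbit; [s] carries it onto its complement, so
   [#|T|] is twice [#|A|]. *)
move=> sK s_neq; pose A := [set x | (enum_rank x < enum_rank (s x))%N].
have sA : s @: A = ~: A.
  apply/setP => x; rewrite -[x in LHS]sK mem_imset ?inE; last exact: inv_inj.
  rewrite sK -leqNgt ltn_neqAle (inj_eq val_inj) (inj_eq enum_rank_inj).
  by rewrite s_neq.
by rewrite -(cardsC A) -sA card_imset ?addnn ?odd_double //; apply: inv_inj.
Qed.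

Section GraphLie.
Variables (R : realFieldType) (G : sgraph).
Local Notation nG := (nlie R G).
Local Notation br := (@nbracket R G).
Implicit Types (u v w : G) (e : edge G) (b : G + edge G).

Lemma nbasis_neq0 b : nbasis R b != 0.
Proof. by apply/eqP => /ffunP/(_ b)/eqP; rewrite !ffunE eqxx oner_eq0. Qed.

Lemma nbracket_central (x y : nG) : central br (br x y).
Proof. by move=> z; apply/ffunP => -[u|e]; rewrite !ffunE // !mul0r subrr. Qed.

Lemma adj_edge u v : adj u v ->
  exists2 e, val e = (u, v) \/ val e = (v, u)
  & br (nbasis R (inl u)) (nbasis R (inl v)) = nbasis R (inr e) \/
    br (nbasis R (inl u)) (nbasis R (inl v)) = - nbasis R (inr e).
Proof.
move=> uv; have [lt_uv|lt_vu|/ord_inj/enum_rank_inj eq_uv] :=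
    ltngtP (enum_rank u) (enum_rank v).
- have e_uv : (enum_rank (u, v).1 < enum_rank (u, v).2)%N && adj (u, v).1 (u, v).2.
    exact/andP.
  exists (Sub (u, v) e_uv); first by left.
  by left; rewrite -nbracket_adj.
- have e_vu : (enum_rank (v, u).1 < enum_rank (v, u).2)%N && adj (v, u).1 (v, u).2.
    by rewrite /= lt_vu adj_sym.
  exists (Sub (v, u) e_vu); first by right.
  by right; rewrite -nbracket_adj (brC (nbracket_lie R G)).
- by rewrite eq_uv adj_irr in uv.
Qed.

Lemma adj_nbracket_neq0 u v :
  adj u v -> br (nbasis R (inl u)) (nbasis R (inl v)) != 0.
Proof. by case/adj_edge => e _ [] ->; rewrite ?oppr_eq0 nbasis_neq0. Qed.

Lemma deg_gt0P v : reflect (exists w, adj v w) (0 < deg v)%N.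
Proof.
apply: (iffP card_gt0P) => -[w]; rewrite ?inE => vw; exists w => //.
by rewrite inE.
Qed.

Lemma deg0_central v : ~~ (0 < deg v)%N -> central br (nbasis R (inl v)).
Proof.
move=> v0 y; apply/ffunP => -[u|e]; rewrite !ffunE //.
have E (a b : G) : (inl a == inl b :> G + edge G) = (a == b) by [].
case: e => -[c d] /= /andP[_ cd]; rewrite !E.
case: eqP => [cv|_]; first by case/deg_gt0P: v0; exists d; rewrite -cv.
case: eqP => [dv|_]; last by rewrite !mul0r subrr.
by case/deg_gt0P: v0; exists c; rewrite -dv adj_sym.
Qed.

(** Each bracket is zero or an edge up to sign. The second edge has [v] as an endpoint and the first
    does not, so they are distinct and therefore orthogonal. *)
Lemma dot_nbracket_edges (g : {dot nG for idfun}) u u' v v' :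
    (forall e f, e != f -> g (nbasis R (inr e)) (nbasis R (inr f)) = 0) ->
    u != v -> u' != v ->
  g (br (nbasis R (inl u)) (nbasis R (inl u')))
    (br (nbasis R (inl v)) (nbasis R (inl v'))) = 0.
Proof.
move=> gE uv u'v.
have [/adj_edge[e e_u br_u]|/nbracket_nadj->] := boolP (adj u u'); last first.
  by rewrite linear0l.
have [/adj_edge[f f_v br_v]|/nbracket_nadj->] := boolP (adj v v'); last first.
  by rewrite linear0r.
have e_f : e != f.
  apply/eqP => ef; move/eqP: uv; move/eqP: u'v; move: f_v; rewrite -ef.
  by case: e_u => -> [] [? ?]; congruence.
by case: br_u => ->; case: br_v => ->;
   rewrite ?(linearNl, linearNr) /= ?linearNr ?gE ?oppr0.
Qed.

Variables (J : {linear nG -> nG}) (s : G + edge G -> G + edge G).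
Hypothesis JJ : forall x, J (J x) = - x.
Hypothesis Js : forall b,
  J (nbasis R b) = nbasis R (s b) \/ - J (nbasis R b) = nbasis R (s b).

Lemma nbasis_inj : injective (@nbasis R G).
Proof.
move=> b c /ffunP/(_ b); rewrite !ffunE eqxx; case: eqP => // _ /eqP.
by rewrite oner_eq0.
Qed.

Lemma nbasis_neqN b c : nbasis R b <> - nbasis R c.
Proof.
move=> /ffunP/(_ b); rewrite !ffunE eqxx => /eqP.
by rewrite -addr_eq0 -natrD pnatr_eq0.
Qed.

Lemma JpermP b :
  J (nbasis R b) = nbasis R (s b) \/ J (nbasis R b) = - nbasis R (s b).
Proof. by case: (Js b) => [->|<-]; [left|right; rewrite opprK]. Qed.

(** A fixed point would give J b = b or J b = -b, and in both cases J^2 b = b, against J^2 = -Id. *)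
Lemma Jperm_neq b : s b != b.
Proof.
apply/eqP => sb; have := JJ (nbasis R b).
case: (JpermP b); rewrite sb => Jb; rewrite Jb ?raddfN /= Jb ?opprK;
  exact: nbasis_neqN.
Qed.

(** J^2 sends b to [s (s b)] up to sign and also to -b. No basis vector is the negative of a basis
    vector, so the sign is minus and the two basis vectors agree. *)
Lemma Jperm_inv : involutive s.
Proof.
move=> b; have := JJ (nbasis R b).
case: (JpermP b) => ->; rewrite ?raddfN /=; case: (JpermP (s b)) => ->;
  by rewrite ?opprK; move=> /nbasis_neqN || move=> /oppr_inj/nbasis_inj.
Qed.

Lemma adapted_card_even : ~~ odd (#|G| + #|edge G|).
Proof. by rewrite -card_sum; apply: involution_card_even Jperm_inv Jperm_neq. Qed.

(** * Consequences of the SKT condition for adjacency *)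

Variable g : {dot nG for idfun}.
Hypothesis gJ_skt : skt_metric br J g.
Hypothesis gE : forall e f, e != f -> g (nbasis R (inr e)) (nbasis R (inr f)) = 0.
Hypothesis deg_orth : forall v, (0 < deg v)%N ->
  forall z : nG, central br z -> g (nbasis R (inl v)) z = 0.

Lemma bracket_orth v : (0 < deg v)%N ->
  forall x y : nG, g (br x y) (nbasis R (inl v)) = 0.
Proof. by move=> v_gt0 x y; rewrite dotC deg_orth //; apply: nbracket_central. Qed.

Lemma bracket_orthJ v w : s (inl v) = inl w -> (0 < deg w)%N ->
  forall x y : nG, g (br x y) (J (nbasis R (inl v))) = 0.
Proof.
move=> sv w_gt0 x y; case: (JpermP (inl v)) => ->;
  by rewrite sv ?linearNr /= bracket_orth ?oppr0.
Qed.

(** If [s (inl v)] were central, [skt_J_central] would apply to it, since its image under J is v up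
    to sign and v is orthogonal to all brackets. Then v would be central, although it has a
    neighbour. Edges and isolated vertices are central, so [s (inl v)] is neither. *)
Lemma Jperm_deg_gt0 v : (0 < deg v)%N ->
  exists2 w, s (inl v) = inl w & (0 < deg w)%N.
Proof.
move=> v_gt0.
have ncentral_v : ~ central br (nbasis R (inl v)).
  by case/deg_gt0P: v_gt0 => w /adj_nbracket_neq0/eqP vw /(_ (nbasis R (inl w))).
have ncentral_sv : ~ central br (nbasis R (s (inl v))).
  move=> c_sv; apply: ncentral_v.
  have : central br (J (nbasis R (s (inl v)))).
    apply: (skt_J_central (nbracket_lie R G) nbracket_central gJ_skt) => // x y.
    by case: (JpermP (s (inl v))) => ->; rewrite Jperm_inv ?linearNr /= bracket_orth
       ?oppr0.
  case: (JpermP (s (inl v))) => ->; rewrite Jperm_inv // => cNv y.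
  by apply/oppr_inj; rewrite -(brNl (nbracket_lie R G)) cNv oppr0.
case: (s (inl v)) ncentral_sv => [w|e]; last by case; apply: nbracket_edge.
move=> ncentral_w; exists w => //; apply/negPn/negP => /deg0_central.
exact: ncentral_w.
Qed.

(** Otherwise w differs from v and from its partner v', and [skt_bracket_eq0] forces [v, w] = 0,
    although the bracket of adjacent vertices is nonzero. *)
Lemma adj_Jperm v w : adj v w -> s (inl v) = inl w.
Proof.
move=> vw.
have v_gt0 : (0 < deg v)%N by apply/deg_gt0P; exists w.
have w_gt0 : (0 < deg w)%N by apply/deg_gt0P; exists v; rewrite adj_sym.
have [v' sv v'_gt0] := Jperm_deg_gt0 v_gt0.
have [w' sw w'_gt0] := Jperm_deg_gt0 w_gt0.
rewrite sv; congr inl; apply/eqP/contraT => v'w.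
have [v_w|v_w] := eqVneq v w; first by rewrite v_w adj_irr in vw.
have := adj_nbracket_neq0 vw; rewrite (_ : br _ _ = 0) ?eqxx //.
apply: (skt_bracket_eq0 (nbracket_lie R G) gJ_skt).
- exact: bracket_orth.
- exact: bracket_orthJ sv v'_gt0.
- exact: bracket_orth.
- exact: bracket_orthJ sw w'_gt0.
(* Up to sign [v, Jv] and [w, Jw] are [v, v'] and [w, w'], which are orthogonal because w is neither
   v nor v'. The case split only tracks the signs. *)
- have vw0 := dot_nbracket_edges w' gE v_w v'w.
  case: (JpermP (inl v)) => ->; case: (JpermP (inl w)) => ->; rewrite sv sw;
    rewrite ?(brNr (nbracket_lie R G)) ?(linearNl, linearNr) /=;
    by rewrite ?linearNr vw0 ?oppr0.
Qed.
End GraphLie.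

Theorem proposition8p7 (R : realType) (G : sgraph)
    (J : {linear nlie R G -> nlie R G})
    (hJ : adapted_complex_structure J)
    (g : {dot nlie R G for idfun})
    (hskt : skt_metric (@nbracket R G) J g)
    (hE : forall e f : edge G, e != f -> g (nbasis R (inr e)) (nbasis R (inr f)) = 0)
    (hz : forall x : nlie R G,
        (forall z : nlie R G, central (@nbracket R G) z -> g x z = 0)
        <-> x \in <<[seq nbasis R (inl v) | v <- enum G & (0 < deg v)%N]>>%VS) :
  basic G.
Proof.
have [[JJ _] /fin_all_exists[s Js]] := hJ.
apply: matching_basic (adapted_card_even JJ Js) => u v w uv uw.
have deg_orth x : (0 < deg x)%N ->
    forall z, central (@nbracket R G) z -> g (nbasis R (inl x)) z = 0.
  by move=> x_gt0; apply/hz/memv_span/map_f; rewrite mem_filter x_gt0 mem_enum.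
(* Every neighbour of [u] equals [s (inl u)], so there is at most one. *)
have := adj_Jperm JJ Js hskt hE deg_orth uv.
by rewrite (adj_Jperm JJ Js hskt hE deg_orth uw) => -[].
Qed.
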